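(* Let $(\mathbb{T},\tau)$ be a real torus acting on an affine $\mathbb{R}$-variety $(X,\sigma)$. Then there exists $n\in\mathbb{N}$, $n\ge\dim(\mathbb{T})$, such that the following hold: (i) there exists an $\mathbb{R}$-group structure $\tau'$ on $\mathbb{G}_{m,\mathbb{C}}^n$ that extends to an $\mathbb{R}$-structure $\sigma'$ on $\mathbb{A}^n_{\mathbb{C}}$; (ii) $(\mathbb{T},\tau)$ is a closed subgroup of $(\mathbb{G}_{m,\mathbb{C}}^n,\tau')$; and (iii) $(X,\sigma)$ is a closed subvariety of $(\mathbb{A}^n_{\mathbb{C}},\sigma')$ and the closed immersion $(X,\sigma)\hookrightarrow(\mathbb{A}^n_{\mathbb{C}},\sigma')$ is $(\mathbb{T},\tau)$-equivariant.
   Context: A $\mathbb{C}$-variety is a separated integral scheme of finite type over $\mathbb{C}$. An $\mathbb{R}$-structure on a $\mathbb{C}$-variety $X$ is an involution $\sigma$ of the $\mathbb{R}$-scheme $X$ lying over the automorphism of $\mathrm{Spec}(\mathbb{C})$ induced by complex conjugation. Quasi-projective $\mathbb{R}$-varieties are identified with pairs $(X,\sigma)$. An $\mathbb{R}$-morphism $(X,\sigma)\to(X',\sigma')$ is a morphism of $\mathbb{C}$-varieties $f$ with $\sigma'\circ f=f\circ\sigma$. An $\mathbb{R}$-group structure on a complex algebraic group is an $\mathbb{R}$-structure for which multiplication, inverse and unit are $\mathbb{R}$-morphisms. A real torus $(\mathbb{T},\tau)$ is a complex torus $\mathbb{T}$ with an $\mathbb{R}$-group structure $\tau$. $(\mathbb{T},\tau)$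 acts on $(X,\sigma)$ if $\mathbb{T}$ acts on $X$ through $\mu:\mathbb{T}\times X\to X$ with $\sigma\circ\mu=\mu\circ(\tau\times\sigma)$. All torus actions are assumed effective. $\mathbb{G}_{m,\mathbb{C}}^n\subset\mathbb{A}^n_{\mathbb{C}}$ is the standard open embedding, and $\mathbb{G}_{m,\mathbb{C}}^n$ acts on $\mathbb{A}^n_{\mathbb{C}}$ coordinatewise; $\mathbb{T}$ acts on $\mathbb{A}^n_{\mathbb{C}}$ through the inclusion $\mathbb{T}\hookrightarrow\mathbb{G}_{m,\mathbb{C}}^n$ of (ii). ''Closed subgroup'' in (ii) means that this inclusion is a closed immersion of algebraic groups which is an $\mathbb{R}$-morphism; ''closed subvariety'' in (iii) means that $X\hookrightarrow\mathbb{A}^n_{\mathbb{C}}$ is a closed immersion that is an $\mathbb{R}$-morphism; it is $(\mathbb{T},\tau)$-equivariant if moreover it is $\mathbb{T}$-equivariant. *)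

(* Defs.v *)
From mathcomp Require Import all_boot all_order all_algebra.
From mathcomp Require Import complex mpoly.
From mathcomp Require Import reals.

Set Implicit Arguments.
Unset Strict Implicit.
Unset Printing Implicit Defensive.

Import GRing.Theory Num.Theory.
Local Open Scope ring_scope.

(* Varieties are treated in the classical language over the algebraically
   closed field C = R[i]: a variety is its set of closed points, and an affine
   one is determined by its global regular functions, i.e. by the algebra
   C[X] = Gamma(X, O_X) viewed inside the functions X -> C (faithfully, since
   varieties are reduced).  Only affine varieties occur: a torus, the affine
   variety it acts on, A^n, G_m^n, and products of these. *)

Record fun_space (R : realType) := FunSpace {
  pt :> Type;
  regular : (pt -> R[i]) -> Prop
}.

Section Spaces.
Variable R : realType.
Implicit Types X Y Z : fun_space R.

Definition var_morphism X Y (phi : X -> Y) : Prop :=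
  forall f : Y -> R[i], regular f -> regular (fun x => f (phi x)).

(* C[X x Y] = C[X] (x) C[Y] *)
Definition prod_space X Y : fun_space R :=
  @FunSpace R (X * Y)%type (fun h => exists (k : nat)
      (f : 'I_k -> X -> R[i]) (g : 'I_k -> Y -> R[i]),
    [/\ forall i, regular (f i), forall i, regular (g i)
      & forall p, h p = \sum_i f i p.1 * g i p.2]).

(* Closed for the Zariski topology; not necessarily irreducible. *)
Definition zariski_closed Z (V : Z -> Prop) : Prop :=
  exists I : (Z -> R[i]) -> Prop,
    (forall g, I g -> regular g) /\
    (forall z, V z <-> forall g, I g -> g z = 0).

(* For an affine target Z: phi is an isomorphism of X onto a closed subvariety
   of Z, whose regular functions are the restrictions of those of Z. *)
Definition closed_immersion X Z (phi : X -> Z) : Prop :=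
  [/\ var_morphism phi, injective phi,
      zariski_closed (fun z => exists x, phi x = z)
    & forall f : X -> R[i], regular f ->
        exists2 g : Z -> R[i], regular g & forall x, f x = g (phi x)].

Definition affine_space (n : nat) : fun_space R :=
  @FunSpace R {ffun 'I_n -> R[i]} (fun f =>
    exists p : {mpoly R[i][n]}, forall x, f x = p.@[x]).

(* C[X] is an integral domain: a nonzero ring without zero divisors. *)
Definition integral X : Prop :=
  inhabited X /\
  (forall f g : X -> R[i], regular f -> regular g ->
     (forall x, f x * g x = 0) -> (forall x, f x = 0) \/ (forall x, g x = 0)).

Definition affine_variety X : Prop :=
  integral X /\
  exists (m : nat) (e : X -> affine_space m), closed_immersion e.

(* A scheme involution over complex conjugation acts on C[X] by the
   conjugate-linear map f |-> conj o f o sigma. *)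
Definition real_structure X (sigma : X -> X) : Prop :=
  involutive sigma /\
  (forall f : X -> R[i], regular f -> regular (fun x => (f (sigma x))^*)).

Definition real_morphism X Y (sigma : X -> X) (sigma' : Y -> Y) (phi : X -> Y)
    : Prop :=
  var_morphism phi /\ (forall x, sigma' (phi x) = phi (sigma x)).

Definition prod_map (A B : Type) (a : A -> A) (b : B -> B) (p : A * B) : A * B :=
  (a p.1, b p.2).

End Spaces.

Record group_space (R : realType) := GroupSpace {
  gspace :> fun_space R;
  gone : gspace;
  gmul : gspace -> gspace -> gspace;
  ginv : gspace -> gspace
}.
Arguments gone {R} _.

Section Groups.
Variable R : realType.
Implicit Types (G H T : group_space R) (X : fun_space R).

Definition algebraic_group G : Prop :=
  [/\ affine_variety G,
      [/\ associative (@gmul R G), left_id (gone G) (@gmul R G)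
        & left_inverse (gone G) (@ginv R G) (@gmul R G)],
      @var_morphism R (prod_space G G) G (fun p => gmul p.1 p.2)
    & @var_morphism R G G (@ginv R G)].

Definition group_morphism G H (phi : G -> H) : Prop :=
  var_morphism phi /\ (forall s t, phi (gmul s t) = gmul (phi s) (phi t)).

(* The unit Spec C -> G is an R-morphism iff the point 1 is fixed by tau. *)
Definition real_group_structure G (tau : G -> G) : Prop :=
  [/\ real_structure tau,
      @real_morphism R (prod_space G G) G (prod_map tau tau) tau
        (fun p => gmul p.1 p.2),
      @real_morphism R G G tau tau (@ginv R G)
    & tau (gone G) = gone G].

Definition gm_point (n : nat) : Type :=
  {x : {ffun 'I_n -> R[i]} | [forall i, x i != 0]}.

(* G_m^n is the principal open subset x_1 ... x_n <> 0 of A^n, so that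
   C[G_m^n] is the localization C[x_1, ..., x_n][1 / (x_1 ... x_n)]. *)
Definition gm_space (n : nat) : fun_space R :=
  @FunSpace R (gm_point n) (fun f => exists (p : {mpoly R[i][n]}) (k : nat),
    forall x : gm_point n, f x = p.@[val x] / (\prod_i val x i) ^+ k).

Definition gm_incl (n : nat) (x : gm_space n) : affine_space R n := val x.

Fact gm_one_subproof (n : nat) :
  [forall i, [ffun _ : 'I_n => 1 : R[i]] i != 0].
Proof. by apply/forallP => i; rewrite ffunE oner_neq0. Qed.

Fact gm_mul_subproof (n : nat) (x y : gm_point n) :
  [forall i, [ffun i => val x i * val y i] i != 0].
Proof.
apply/forallP => i; rewrite ffunE mulf_neq0 //.
- exact: (forallP (valP x)).
- exact: (forallP (valP y)).
Qed.

Fact gm_inv_subproof (n : nat) (x : gm_point n) :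
  [forall i, [ffun i => (val x i)^-1] i != 0].
Proof. by apply/forallP => i; rewrite ffunE invr_neq0 // (forallP (valP x)). Qed.

Definition gm_mk (n : nat) (x : {ffun 'I_n -> R[i]})
    (hx : [forall i, x i != 0]) : gm_point n :=
  exist _ x hx.

Definition gm (n : nat) : group_space R :=
  @GroupSpace R (gm_space n)
    (gm_mk (gm_one_subproof n))
    (fun x y => gm_mk (gm_mul_subproof x y))
    (fun x => gm_mk (gm_inv_subproof x)).

Definition gm_act (n : nat) (s : gm n) (x : affine_space R n)
    : affine_space R n :=
  [ffun i => val s i * x i].

(* T is a torus and dim T = d *)
Definition torus (d : nat) T : Prop :=
  algebraic_group T /\
  exists (phi : T -> gm d) (psi : gm d -> T),
    [/\ group_morphism phi, group_morphism psi, cancel phi psi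
      & cancel psi phi].

Definition algebraic_action T X (mu : T -> X -> X) : Prop :=
  [/\ @var_morphism R (prod_space T X) X (fun p => mu p.1 p.2),
      forall x, mu (gone T) x = x
    & forall s t x, mu (gmul s t) x = mu s (mu t x)].

Definition effective T X (mu : T -> X -> X) : Prop :=
  forall t, (forall x, mu t x = x) -> t = gone T.

Definition real_torus_action T X (tau : T -> T) (sigma : X -> X)
    (mu : T -> X -> X) : Prop :=
  [/\ algebraic_action mu, effective mu
    & @real_morphism R (prod_space T X) X (prod_map tau sigma) sigma
        (fun p => mu p.1 p.2)].

End Groups.

(* Main.v *)
Require Import Defs.
From mathcomp Require Import all_boot all_order all_algebra.
From mathcomp Require Import complex mpoly.
From mathcomp Require Import reals.
From mathcomp Require Import boolp ring.

Set Implicit Arguments.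
Unset Strict Implicit.
Unset Printing Implicit Defensive.

Import GRing.Theory Num.Theory.
Local Open Scope ring_scope.

(** The torus acts linearly on C[X], and C[X] is the sum of its weight spaces:
    expanding the regular function (t, x) |-> f (t x) along the characters of T,
    which span C[T], gives f (t x) = sum_chi chi(t) f_chi(x), and the
    independence of characters (characters_independent) forces
    f_chi (t x) = chi(t) f_chi(x); at t = 1 the f_chi add up to f
    (weight_decomposition).  Hence C[X] is generated by finitely many weight
    vectors.

    The real structure acts on C[X] by f |-> conj o f o sigma, and this sends a
    vector of weight chi to one of weight conj o chi o tau
    (weight_vector_conj).  So the generators, followed by their conjugates, form
    a finite family f_i with weights chi_i on which conjugation acts by an
    involution s of the indices.  Then j = (f_i) embeds X equivariantly in A^n,
    T mapping to G_m^n by iota = (chi_i), and both embeddings are real for the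
    structure x |-> (conj x_(s i))_i on A^n and its restriction to G_m^n, which
    is compatible with the group law.

    To make iota a closed immersion, the zero function is added to the family
    once for each of d coordinate characters of T, with that character as its
    weight: zero is a weight vector of every weight, so j is still a closed
    immersion, while T becomes a retract of G_m^n and d <= n.  In both cases
    closedness of the image comes from closed_immersion_factor: the image is cut
    out by the equations saying that a point is recovered from its
    projection. *)

(** * Algebras of regular functions *)

Section FunctionAlgebra.
Variable R : realType.
Implicit Types W X Y Z : fun_space R.

Definition function_algebra W : Prop :=
  [/\ forall c : R[i], regular (fun _ : W => c),
      forall f g : W -> R[i], regular f -> regular g ->
        regular (fun x => f x + g x)
    & forall f g : W -> R[i], regular f -> regular g ->
        regular (fun x => f x * g x)].

Lemma eq_regular W (f g : W -> R[i]) : f =1 g -> regular f -> regular g.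
Proof. by move=> /funext ->. Qed.

Lemma regular_sum W (I : Type) (r : seq I) (F : I -> W -> R[i]) :
  function_algebra W -> (forall i, regular (F i)) ->
  regular (fun x => \sum_(i <- r) F i x).
Proof.
move=> [cstW addW _] F_reg; elim: r => [|i r IHr].
  by apply: eq_regular (cstW 0) => x; rewrite big_nil.
by apply: eq_regular (addW _ _ (F_reg i) IHr) => x; rewrite big_cons.
Qed.

Lemma regular_prod W (I : Type) (r : seq I) (F : I -> W -> R[i]) :
  function_algebra W -> (forall i, regular (F i)) ->
  regular (fun x => \prod_(i <- r) F i x).
Proof.
move=> [cstW _ mulW] F_reg; elim: r => [|i r IHr].
  by apply: eq_regular (cstW 1) => x; rewrite big_nil.
by apply: eq_regular (mulW _ _ (F_reg i) IHr) => x; rewrite big_cons.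
Qed.

Lemma regular_exp W (f : W -> R[i]) (k : nat) :
  function_algebra W -> regular f -> regular (fun x => f x ^+ k).
Proof.
move=> [cstW _ mulW] f_reg; elim: k => [|k IHk].
  exact: eq_regular (cstW 1).
by apply: eq_regular (mulW _ _ f_reg IHk) => x; rewrite exprS.
Qed.

Lemma regular_mpoly W (n : nat) (h : W -> {ffun 'I_n -> R[i]})
    (p : {mpoly R[i][n]}) :
  function_algebra W -> (forall i, regular (fun x => h x i)) ->
  regular (fun x => p.@[h x]).
Proof.
move=> algW h_reg; have [cstW _ mulW] := algW.
apply: (@eq_regular _ (fun x =>
  \sum_(m <- msupp p) p@_m * \prod_i h x i ^+ m i)) => [x|].
  by rewrite mevalE.
apply: (regular_sum _ (F := fun m x => p@_m * \prod_i h x i ^+ m i)) => // m.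
apply: mulW => //; apply: (regular_prod _ (F := fun i x => h x i ^+ m i)) => // i.
exact: (regular_exp (f := fun x => h x i)).
Qed.

Lemma affine_space_algebra (n : nat) : function_algebra (affine_space R n).
Proof.
split=> [c|f g [p Dp] [q Dq]|f g [p Dp] [q Dq]].
- by exists c%:MP => x; rewrite mevalC.
- by exists (p + q) => x; rewrite mevalD Dp Dq.
- by exists (p * q) => x; rewrite mevalM Dp Dq.
Qed.

Lemma affine_space_coord (n : nat) (i : 'I_n) :
  regular (fun x : affine_space R n => x i).
Proof. by exists 'X_i => x; rewrite mevalXU. Qed.

Lemma gm_coord_neq0 (n : nat) (x : gm R n) i : val x i != 0.
Proof. exact: (forallP (valP x)). Qed.

Lemma gm_prod_neq0 (n : nat) (x : gm R n) : \prod_i val x i != 0.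
Proof. by apply/prodf_neq0 => i _; exact: gm_coord_neq0. Qed.

(** Fractions with denominators D^k and D^l, where D = X_1 ... X_n, add up to a
    fraction with denominator D^(k+l). *)
Lemma gm_algebra (n : nat) : function_algebra (gm R n).
Proof.
pose D : {mpoly R[i][n]} := \prod_i 'X_i.
have DE (x : gm R n) : D.@[val x] = \prod_i val x i.
  by rewrite rmorph_prod; apply: eq_bigr => i _; rewrite /= mevalXU.
split=> [c|f g [p [k Dp]] [q [l Dq]]|f g [p [k Dp]] [q [l Dq]]].
- by exists c%:MP, 0 => x; rewrite mevalC expr0 divr1.
- exists (p * D ^+ l + q * D ^+ k), (k + l)%N => x.
  rewrite Dp Dq mevalD !mevalM !rmorphXn /= DE exprD.
  have := gm_prod_neq0 x; set u := \prod_i _ => u0.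
  have uk : u ^+ k != 0 by rewrite expf_neq0.
  have ul : u ^+ l != 0 by rewrite expf_neq0.
  by field; rewrite uk ul.
- exists (p * q), (k + l)%N => x.
  by rewrite mevalM Dp Dq exprD invfM mulrACA.
Qed.

Lemma gm_coord (n : nat) (i : 'I_n) : regular (fun x : gm R n => val x i).
Proof. by exists 'X_i, 0 => x; rewrite mevalXU expr0 divr1. Qed.

(** 1 / x_i is the product of the other coordinates divided by that of all the
    coordinates. *)
Lemma gm_coord_inv (n : nat) (i : 'I_n) :
  regular (fun x : gm R n => (val x i)^-1).
Proof.
exists (\prod_(j | j != i) 'X_j), 1 => x.
have -> : (\prod_(j | j != i) 'X_j).@[val x] = \prod_(j | j != i) val x j.
  by rewrite rmorph_prod; apply: eq_bigr => j _; rewrite /= mevalXU.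
rewrite expr1 [X in _ / X](bigD1 i) //= invfM mulrCA divff ?mulr1 //.
by apply/prodf_neq0 => j _; exact: gm_coord_neq0.
Qed.

Lemma gm_val_inj (n : nat) (x y : gm R n) :
  (forall i, val x i = val y i) -> x = y.
Proof. by move=> xy; apply: val_inj; apply/ffunP. Qed.

(** Lets tensors be indexed by any finite type; sums and products of regular
    functions on X x Y are naturally indexed by disjoint sums and products. *)
Lemma regular_tensor X Y (J : finType)
    (f : J -> X -> R[i]) (g : J -> Y -> R[i]) :
  (forall j, regular (f j)) -> (forall j, regular (g j)) ->
  @regular R (prod_space X Y) (fun p => \sum_j f j p.1 * g j p.2).
Proof.
move=> f_reg g_reg.
exists #|J|, (fun i => f (enum_val i)), (fun i => g (enum_val i)).
split=> // p; rewrite (reindex (@enum_val J predT)) //=.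
exact/onW_bij/enum_val_bij.
Qed.

Lemma prod_space_algebra X Y :
  function_algebra X -> function_algebra Y -> function_algebra (prod_space X Y).
Proof.
move=> [cstX addX mulX] [cstY addY mulY].
split=> [c|h1 h2 [k1 [f1 [g1 [f1r g1r Dh1]]]] [k2 [f2 [g2 [f2r g2r Dh2]]]]
          |h1 h2 [k1 [f1 [g1 [f1r g1r Dh1]]]] [k2 [f2 [g2 [f2r g2r Dh2]]]]].
- exists 1, (fun _ _ => c), (fun _ _ => 1); split=> // p.
  by rewrite big_ord1 mulr1.
- pose f (j : 'I_k1 + 'I_k2) := match j with inl a => f1 a | inr b => f2 b end.
  pose g (j : 'I_k1 + 'I_k2) := match j with inl a => g1 a | inr b => g2 b end.
  have fg_reg : @regular R (prod_space X Y) (fun p => \sum_j f j p.1 * g j p.2).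
    by apply: regular_tensor; case.
  by apply: eq_regular fg_reg => p; rewrite big_sumType /= Dh1 Dh2.
- pose f (j : 'I_k1 * 'I_k2) x := f1 j.1 x * f2 j.2 x.
  pose g (j : 'I_k1 * 'I_k2) y := g1 j.1 y * g2 j.2 y.
  have fg_reg : @regular R (prod_space X Y) (fun p => \sum_j f j p.1 * g j p.2).
    by apply: regular_tensor => j; [apply: mulX | apply: mulY].
  apply: eq_regular fg_reg => p; rewrite Dh1 Dh2 big_distrlr pair_bigA /=.
  by apply: eq_bigr => j _; rewrite mulrACA.
Qed.

Lemma regular_fst X Y (f : X -> R[i]) :
  function_algebra Y -> regular f ->
  @regular R (prod_space X Y) (fun p => f p.1).
Proof.
move=> [cstY _ _] f_reg; exists 1, (fun _ => f), (fun _ _ => 1).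
by split=> // p; rewrite big_ord1 mulr1.
Qed.

Lemma regular_snd X Y (g : Y -> R[i]) :
  function_algebra X -> regular g ->
  @regular R (prod_space X Y) (fun p => g p.2).
Proof.
move=> [cstX _ _] g_reg; exists 1, (fun _ _ => 1), (fun _ => g).
by split=> // p; rewrite big_ord1 mul1r.
Qed.

Lemma closed_immersion_algebra X Z (e : X -> Z) :
  closed_immersion e -> function_algebra Z -> function_algebra X.
Proof.
move=> [e_mor _ _ e_ext] [cstZ addZ mulZ].
split=> [c|f g /e_ext[p p_reg Dp] /e_ext[q q_reg Dq]
          |f g /e_ext[p p_reg Dp] /e_ext[q q_reg Dq]].
- exact: (e_mor _ (cstZ c)).
- by apply: eq_regular (e_mor _ (addZ _ _ p_reg q_reg)) => x; rewrite Dp Dq.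
- by apply: eq_regular (e_mor _ (mulZ _ _ p_reg q_reg)) => x; rewrite Dp Dq.
Qed.

Lemma affine_variety_algebra X : affine_variety X -> function_algebra X.
Proof.
move=> [_ [m [e e_imm]]].
exact: closed_immersion_algebra e_imm (affine_space_algebra m).
Qed.

Lemma morphism_to_affine_space W (n : nat) (h : W -> affine_space R n) :
  function_algebra W -> (forall i, regular (fun x => h x i)) ->
  var_morphism h.
Proof.
move=> algW h_reg f [p Dp].
apply: eq_regular (regular_mpoly (h := h) p algW h_reg) => x.
by rewrite Dp.
Qed.

(** The coordinates and their inverses generate C[G_m^n]. *)
Lemma morphism_to_gm W (n : nat) (h : W -> gm R n) :
  function_algebra W -> (forall i, regular (fun x => val (h x) i)) ->
  (forall i, regular (fun x => (val (h x) i)^-1)) -> var_morphism h.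
Proof.
move=> algW h_reg hV_reg f [p [k Dp]]; have [_ _ mulW] := algW.
apply: (@eq_regular _ (fun x =>
  p.@[val (h x)] * (\prod_i (val (h x) i)^-1) ^+ k)) => [x|].
  by rewrite Dp -exprVn prodfV.
apply: mulW; first exact: (regular_mpoly (h := fun x => val (h x))).
apply: (regular_exp (f := fun x => \prod_i (val (h x) i)^-1)) => //.
exact: (regular_prod _ (F := fun i x => (val (h x) i)^-1)).
Qed.

(** * Closed immersions recognised by a factorisation *)

(** If j and the closed immersion e are obtained from each other by composing
    with morphisms P and Q between their targets, then the image of j consists
    of the z such that Q z lies in the image of e and P (Q z) = z.  The first
    condition is closed by pulling back equations along Q; the second is closed
    because regular functions separate the points of Z. *)
Lemma closed_immersion_factor X Y Z (e : X -> Y) (j : X -> Z)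
    (P : Y -> Z) (Q : Z -> Y) :
  closed_immersion e -> var_morphism P -> var_morphism Q ->
  (forall x, P (e x) = j x) -> (forall x, Q (j x) = e x) ->
  function_algebra Z ->
  (forall z z' : Z, (forall g, regular g -> g z = g z') -> z = z') ->
  closed_immersion j.
Proof.
move=> [e_mor e_inj [I [I_reg I_van]] e_ext] P_mor Q_mor PeE QjE
  [cstZ addZ mulZ] Z_sep.
split.
- move=> g g_reg; apply: eq_regular (e_mor _ (P_mor _ g_reg)) => x /=.
  by rewrite PeE.
- by move=> x y jxy; apply: e_inj; rewrite -!QjE jxy.
- exists (fun g => (exists2 g0, I g0 & g = g0 \o Q) \/
    (exists2 g0, regular g0 & g = fun z => g0 z + (-1) * g0 (P (Q z)))).
  split=> [g [[g0 I_g0 ->]|[g0 g0_reg ->]]|z].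
  + exact: Q_mor _ (I_reg _ I_g0).
  + by apply: addZ => //; apply: mulZ => //; exact: Q_mor _ (P_mor _ g0_reg).
  split=> [[x <-] g [[g0 I_g0 ->]|[g0 g0_reg ->]]|van].
  + by rewrite /= QjE; apply: (I_van _).1 I_g0; exists x.
  + by rewrite QjE PeE mulN1r subrr.
  have [x Dx] : exists x, e x = Q z.
    by apply/I_van => g I_g; apply: (van (g \o Q)); left; exists g.
  exists x; rewrite -PeE Dx; apply: Z_sep => g g_reg; apply/esym/eqP.
  rewrite -subr_eq0 -mulN1r; apply/eqP.
  by apply: (van (fun z => g z + (-1) * g (P (Q z)))); right; exists g.
- move=> f /e_ext[g g_reg Dg]; exists (g \o Q) => [|x]; first exact: Q_mor.
  by rewrite Dg /= QjE.
Qed.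

Lemma closed_immersion_id X : closed_immersion (@id X).
Proof.
split=> // [|f f_reg]; last by exists f.
by exists (fun _ => False); split=> // x; split=> // _; exists x.
Qed.

Lemma affine_space_separated (n : nat) (z z' : affine_space R n) :
  (forall g, regular g -> g z = g z') -> z = z'.
Proof. by move=> zz'; apply/ffunP => i; exact: zz' (affine_space_coord i). Qed.

Lemma gm_separated (n : nat) (z z' : gm R n) :
  (forall g, regular g -> g z = g z') -> z = z'.
Proof. by move=> zz'; apply: gm_val_inj => i; exact: zz' (gm_coord i). Qed.

End FunctionAlgebra.

(** * Characters and weight vectors *)

Section Characters.
Variable R : realType.
Implicit Types (T : group_space R) (X : fun_space R).

Definition character T (chi : T -> R[i]) : Prop :=
  [/\ regular chi, forall s t, chi (gmul s t) = chi s * chi t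
    & forall t, chi t != 0].

(** Artin's argument: from a relation, subtract chi0(s) times itself from its
    translate by s; this removes chi0 and multiplies the coefficient of chi by
    chi(s) - chi0(s), which is nonzero for a suitable s. *)
Lemma characters_independent T (S : seq (T -> R[i])) (c : (T -> R[i]) -> R[i]) :
  uniq S -> (forall chi, chi \in S -> character chi) ->
  (forall t, \sum_(chi <- S) c chi * chi t = 0) ->
  forall chi, chi \in S -> c chi = 0.
Proof.
elim: S c => [//|chi0 S IHS] c /= /andP[chi0S S_uniq] S_char c_rel.
have [chi0_reg chi0M chi0_neq0] := S_char _ (mem_head _ _).
have S_char' chi : chi \in S -> character chi.
  by move=> chiS; apply: S_char; rewrite inE chiS orbT.
have c_S chi : chi \in S -> c chi = 0.
  move=> chiS.
  have [s chi_s] : exists s, chi s != chi0 s.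
    apply: contrapT => /forallNP chi_chi0; move: chi0S.
    suff <- : chi = chi0 by rewrite chiS.
    by apply/funext => s; apply/eqP/negPn/negP/chi_chi0.
  have rel_s t : \sum_(chi' <- S) c chi' * (chi' s - chi0 s) * chi' t = 0.
    apply: (@etrans _ _ (\sum_(chi' <- chi0 :: S) c chi' * chi' (gmul s t) -
      chi0 s * \sum_(chi' <- chi0 :: S) c chi' * chi' t)); last first.
      by rewrite !c_rel mulr0 subrr.
    rewrite mulr_sumr -sumrB big_cons chi0M mulrCA subrr add0r.
    by apply: eq_big_seq => chi' /S_char'[_ -> _]; ring.
  have /eqP := IHS (fun chi' => c chi' * (chi' s - chi0 s))
    S_uniq S_char' rel_s _ chiS.
  by rewrite mulf_eq0 subr_eq0 (negPf chi_s) orbF => /eqP.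
move=> chi; rewrite inE => /orP[/eqP->|/c_S //].
have /eqP := c_rel (gone T); rewrite big_cons big_seq big1 => [|chi' chi'S].
  by rewrite addr0 mulf_eq0 (negPf (chi0_neq0 _)) orbF => /eqP.
by rewrite c_S ?mul0r.
Qed.

Lemma character1 T chi : algebraic_group T -> @character T chi ->
  chi (gone T) = 1.
Proof.
move=> [_ [_ one_mul _] _ _] [_ chiM chi_neq0]; apply: (mulfI (chi_neq0 (gone T))).
by rewrite -chiM one_mul mulr1.
Qed.

Lemma characterV T chi t : algebraic_group T -> @character T chi ->
  chi (ginv t) = (chi t)^-1.
Proof.
move=> algT chi_char; have [_ chiM chi_neq0] := chi_char.
have [_ [_ _ mulVt] _ _] := algT.
apply: (mulIf (chi_neq0 t)); rewrite -chiM mulVt mulVf //.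
exact: character1.
Qed.

Lemma character_conj T (tau : T -> T) chi :
  real_group_structure tau -> character chi ->
  character (fun t => (chi (tau t))^*).
Proof.
move=> [[_ tau_reg] [_ tauM] _ _] [chi_reg chiM chi_neq0]; split=> [|s t|t].
- exact: tau_reg.
- by rewrite (tauM (s, t)) chiM rmorphM.
- by rewrite fmorph_eq0.
Qed.

Lemma torus_coord_character T (d : nat) (phi : T -> gm R d) (i : 'I_d) :
  group_morphism phi -> character (fun t => val (phi t) i).
Proof.
move=> [phi_mor phiM]; split=> [|s t|t].
- exact: (phi_mor (fun x : gm R d => val x i) (gm_coord R i)).
- by rewrite phiM ffunE.
- exact: gm_coord_neq0.
Qed.

(** A regular function on G_m^d is a Laurent polynomial, and Laurent monomials
    are characters. *)
Lemma regular_on_torus T (d : nat) (a : T -> R[i]) :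
  torus d T -> regular a ->
  exists (N : nat) (c : 'I_N -> R[i]) (chi : 'I_N -> T -> R[i]),
    (forall i, character (chi i)) /\
    (forall t, a t = \sum_i c i * chi i t).
Proof.
move=> [algT [phi [psi [phi_mor psi_mor phiK psiK]]]] a_reg.
have [p [k Dp]] := psi_mor.1 _ a_reg.
have algGm := gm_algebra R d.
have [_ _ mulGm] := algGm.
pose mono (m : 'X_{1..d}) (x : gm R d) : R[i] :=
  (\prod_i val x i ^+ m i) * (\prod_i (val x i)^-1) ^+ k.
exists (size (msupp p)), (fun i => p@_(nth 0%MM (msupp p) i)),
  (fun i t => mono (nth 0%MM (msupp p) i) (phi t)); split=> [i|t].
  move: (nth _ _ i) => m; split=> [|s t|t].
  - apply: (phi_mor.1 (mono m)); apply: mulGm.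
      apply: (regular_prod _ (F := fun i (x : gm R d) => val x i ^+ m i)) => // j.
      exact: (regular_exp (f := fun x : gm R d => val x j) _ _ (gm_coord R j)).
    apply: (regular_exp (f := fun x : gm R d => \prod_i (val x i)^-1)) => //.
    exact: (regular_prod _ (F := fun i (x : gm R d) => (val x i)^-1)
      algGm (@gm_coord_inv R d)).
  - rewrite phi_mor.2 /mono mulrACA -exprMn -!big_split /=.
    congr (_ * _ ^+ _); apply: eq_bigr => j _; rewrite ffunE.
      exact: exprMn.
    exact: invfM.
  - rewrite mulf_neq0 ?expf_neq0 //; apply/prodf_neq0 => j _.
      by rewrite expf_neq0 // gm_coord_neq0.
    by rewrite invr_neq0 // gm_coord_neq0.
rewrite -[in LHS](phiK t) Dp mevalE mulr_suml.
rewrite (big_nth 0%MM) big_mkord; apply: eq_bigr => i _.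
by rewrite /mono prodfV exprVn mulrA.
Qed.

Definition weight_vector T X (mu : T -> X -> X) (chi : T -> R[i])
    (f : X -> R[i]) : Prop :=
  [/\ character chi, regular f & forall t x, f (mu t x) = chi t * f x].

(** The coaction C[X] -> C[T] (x) C[X], with its first tensor factors expanded
    into characters. *)
Lemma action_expansion T X (d : nat) (mu : T -> X -> X) (f : X -> R[i]) :
  torus d T -> function_algebra X -> algebraic_action mu -> regular f ->
  exists (J : finType) (chi : J -> T -> R[i]) (g : J -> X -> R[i]),
    [/\ forall j, character (chi j), forall j, regular (g j)
      & forall t x, f (mu t x) = \sum_j chi j t * g j x].
Proof.
move=> torT [cstX _ mulX] [mu_mor _ _] f_reg.
have [k [a [b [a_reg b_reg Df]]]] := mu_mor _ f_reg.
have /fin_all_exists[u Du] (i : 'I_k) : exists u : {N : nat &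
    (('I_N -> R[i]) * ('I_N -> T -> R[i]))%type},
    (forall j, character ((projT2 u).2 j)) /\
    (forall t, a i t = \sum_j (projT2 u).1 j * (projT2 u).2 j t).
  have [N [c [chi [chi_char Da]]]] := regular_on_torus torT (a_reg i).
  by exists (existT _ N (c, chi)).
exists {i : 'I_k & 'I_(projT1 (u i))},
  (fun j => (projT2 (u (tag j))).2 (tagged j)),
  (fun j x => (projT2 (u (tag j))).1 (tagged j) * b (tag j) x).
split=> [j|j|t x].
- exact: (Du _).1.
- exact: mulX.
rewrite (Df (t, x)) /= (eq_bigr (fun i => \sum_(j < projT1 (u i))
  (projT2 (u i)).2 j t * ((projT2 (u i)).1 j * b i x))) => [|i _].
  by rewrite sig_big_dep.
by rewrite (Du i).2 mulr_suml; apply: eq_bigr => j _; ring.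
Qed.

(** Expanding f (s (t x)) as f ((s t) x) or as the coaction at the point t x
    gives, for fixed t and x, two combinations of the characters of s; equal
    coefficients mean that the components of f are weight vectors. *)
Lemma weight_decomposition T X (d : nat) (mu : T -> X -> X) (f : X -> R[i]) :
  torus d T -> function_algebra X -> algebraic_action mu -> regular f ->
  exists (N : nat) (chi : 'I_N -> T -> R[i]) (h : 'I_N -> X -> R[i]),
    (forall i, weight_vector mu (chi i) (h i)) /\
    (forall x, f x = \sum_i h i x).
Proof.
move=> torT algX act_mu f_reg; have algT := torT.1.
have [J [chi [g [chi_char g_reg Df]]]] := action_expansion torT algX act_mu f_reg.
have [_ mu1 muM] := act_mu.
pose S := undup [seq chi j | j : J].
pose G (xi : T -> R[i]) x := \sum_(j | chi j == xi) g j x.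
have S_char xi : xi \in S -> character xi.
  by rewrite mem_undup => /mapP[j _ ->].
have DfG t x : f (mu t x) = \sum_(xi <- S) xi t * G xi x.
  (* Sort the terms of the expansion by their character. *)
  rewrite Df; under [RHS]eq_bigr do rewrite mulr_sumr big_mkcond.
  rewrite exchange_big /=; apply: eq_bigr => j _.
  have jS : chi j \in S by rewrite mem_undup; apply: map_f; rewrite mem_enum.
  rewrite (bigD1_seq _ jS) ?undup_uniq //= eqxx big1 ?addr0 // => xi.
  by rewrite eq_sym => /negPf->.
have G_wt xi t x : xi \in S -> G xi (mu t x) = xi t * G xi x.
  move=> xiS; apply/eqP; rewrite -subr_eq0; apply/eqP.
  pose c (xi : T -> R[i]) := G xi (mu t x) - xi t * G xi x.
  apply: (characters_independent (S := S) (c := c)) xiS => // [|s].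
    exact: undup_uniq.
  under eq_bigr do rewrite mulrBl; rewrite sumrB; apply/eqP; rewrite subr_eq0.
  under eq_bigr do rewrite mulrC; rewrite -DfG -muM DfG; apply/eqP.
  apply: eq_big_seq => eta etaS; have [_ -> _] := S_char _ etaS; ring.
have tnthS i : tnth (in_tuple S) i \in S := mem_tnth i (in_tuple S).
exists (size S), (tnth (in_tuple S)), (fun i => G (tnth (in_tuple S) i)).
split=> [i|x].
  split=> [||t x]; [exact: S_char | | exact: G_wt].
  apply: eq_regular (regular_sum
    [seq j <- enum J | chi j == tnth (in_tuple S) i] algX g_reg) => x.
  by rewrite big_filter big_enum_cond.
rewrite -[in LHS](mu1 x) DfG (big_tnth _ _ S); apply: eq_bigr => i _.
by rewrite character1 ?mul1r //; apply: S_char.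
Qed.

Lemma weight_vector_conj T X (tau : T -> T) (sigma : X -> X)
    (mu : T -> X -> X) chi f :
  real_group_structure tau -> real_structure sigma ->
  (forall t x, sigma (mu t x) = mu (tau t) (sigma x)) ->
  weight_vector mu chi f ->
  weight_vector mu (fun t => (chi (tau t))^*) (fun x => (f (sigma x))^*).
Proof.
move=> real_tau [_ sigma_reg] mu_sigma [chi_char f_reg f_wt].
split=> [||t x]; [exact: character_conj | exact: sigma_reg |].
by rewrite mu_sigma f_wt rmorphM.
Qed.

End Characters.

(** * Conjugation with permuted coordinates *)

Section PermutedConjugation.
Variables (R : realType) (n : nat) (s : 'I_n -> 'I_n).

(** Conjugating the value of p amounts to conjugating the coefficients of p and
    the arguments. *)
Lemma regular_mpoly_conj (W : fun_space R) (k : nat)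
    (h : W -> {ffun 'I_k -> R[i]}) (p : {mpoly R[i][k]}) :
  function_algebra W -> (forall i, regular (fun x => (h x i)^*)) ->
  regular (fun x => (p.@[h x])^*).
Proof.
move=> algW h_reg.
pose q : {mpoly R[i][k]} := \sum_(m <- msupp p) (p@_m)^* *: 'X_[m].
apply: (@eq_regular _ _ (fun x => q.@[[ffun i => (h x i)^*]])) => [x|].
  rewrite raddf_sum [in RHS]mevalE rmorph_sum; apply: eq_bigr => m _ /=.
  rewrite mevalZ mevalX rmorphM rmorph_prod; congr (_ * _).
  by apply: eq_bigr => i _; rewrite ffunE rmorphXn.
apply: (regular_mpoly (h := fun x => [ffun i => (h x i)^*])) => // i.
by apply: eq_regular (h_reg i) => x; rewrite ffunE.
Qed.

Definition affine_conj (x : affine_space R n) : affine_space R n :=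
  [ffun i => (x (s i))^*].

Lemma gm_conj_subproof (x : gm R n) :
  [forall i, [ffun i => (val x (s i))^*] i != 0].
Proof. by apply/forallP => i; rewrite ffunE fmorph_eq0 gm_coord_neq0. Qed.

Definition gm_conj (x : gm R n) : gm R n := gm_mk (gm_conj_subproof x).

Lemma affine_conj_real_structure :
  involutive s -> real_structure affine_conj.
Proof.
move=> s_invol; split=> [x|f [p Dp]].
  by apply/ffunP => i; rewrite !ffunE conjCK s_invol.
apply: (@eq_regular _ _ (fun x => (p.@[affine_conj x])^*)) => [x|].
  by rewrite Dp.
apply: (regular_mpoly_conj (h := affine_conj)) => [|i].
  exact: affine_space_algebra.
apply: eq_regular (affine_space_coord R (s i)) => x.
by rewrite ffunE conjCK.
Qed.

(** The conjugate of p / D^k keeps a denominator of the same form, since s only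
    permutes the factors of D. *)
Lemma gm_conj_real_structure : involutive s -> real_structure gm_conj.
Proof.
move=> s_invol.
have algGm := gm_algebra R n; have [_ _ mulGm] := algGm.
split=> [x|f [p [k Dp]]].
  by apply: gm_val_inj => i; rewrite !ffunE conjCK s_invol.
apply: (@eq_regular _ _ (fun x =>
    (p.@[val (gm_conj x)])^* * (\prod_i (val x (s i))^-1) ^+ k)) => [x|].
  rewrite Dp rmorphM fmorphV rmorphXn -exprVn rmorph_prod /= -prodfV.
  by congr (_ * _ ^+ _); apply: eq_bigr => i _; rewrite ffunE conjCK.
apply: mulGm.
  apply: (regular_mpoly_conj (h := fun x => val (gm_conj x))) => // i.
  by apply: eq_regular (gm_coord R (s i)) => x; rewrite ffunE conjCK.
apply: (regular_exp (f := fun x : gm R n => \prod_i (val x (s i))^-1)) => //.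
apply: (regular_prod _ (F := fun i (x : gm R n) => (val x (s i))^-1)) => // i.
exact: gm_coord_inv.
Qed.

Lemma gm_conj_real_group_structure :
  involutive s -> real_group_structure gm_conj.
Proof.
move=> s_invol.
have algGm := gm_algebra R n.
have algGm2 := prod_space_algebra algGm algGm; have [_ _ mulGm2] := algGm2.
have fst_reg (f : gm R n -> R[i]) := @regular_fst _ (gm R n) (gm R n) f algGm.
have snd_reg (f : gm R n -> R[i]) := @regular_snd _ (gm R n) (gm R n) f algGm.
split.
- exact: gm_conj_real_structure.
- split=> [|p]; last first.
    by apply: gm_val_inj => i; rewrite !ffunE rmorphM.
  apply: morphism_to_gm => // i.
    apply: eq_regular (mulGm2 _ _ (fst_reg _ (gm_coord R i))
      (snd_reg _ (gm_coord R i))) => p.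
    by rewrite ffunE.
  apply: eq_regular (mulGm2 _ _ (fst_reg _ (gm_coord_inv R i))
    (snd_reg _ (gm_coord_inv R i))) => p.
  by rewrite ffunE invfM.
- split=> [|x]; last first.
    by apply: gm_val_inj => i; rewrite !ffunE fmorphV.
  apply: morphism_to_gm => // i.
    by apply: eq_regular (gm_coord_inv R i) => x; rewrite ffunE.
  by apply: eq_regular (gm_coord R i) => x; rewrite ffunE invrK.
- by apply: gm_val_inj => i; rewrite !ffunE rmorph1.
Qed.

End PermutedConjugation.

(** * Equivariant real embeddings *)

Section Linearisation.
Variable R : realType.

(** A family of weight vectors stable under conjugation through s gives the
    embeddings.  The map Q expresses that the family generates C[X], the
    coordinates of e being generators; the map r is a retraction of G_m^n onto
    T, which is what makes iota a closed immersion. *)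
Lemma real_linearisation (T : group_space R) (tau : T -> T)
    (X : fun_space R) (sigma : X -> X) (mu : T -> X -> X)
    (n m : nat) (s : 'I_n -> 'I_n)
    (chi : 'I_n -> T -> R[i]) (f : 'I_n -> X -> R[i])
    (e : X -> affine_space R m) (Q : affine_space R n -> affine_space R m)
    (r : gm R n -> T) :
  algebraic_group T -> closed_immersion e -> involutive s ->
  (forall i, weight_vector mu (chi i) (f i)) ->
  (forall i t, chi (s i) t = (chi i (tau t))^*) ->
  (forall i x, f (s i) x = (f i (sigma x))^*) ->
  var_morphism Q -> (forall x, Q [ffun i => f i x] = e x) ->
  var_morphism r ->
  (forall (z : gm R n) t, (forall i, val z i = chi i t) -> r z = t) ->
  exists (tau' : gm R n -> gm R n)
         (sigma' : affine_space R n -> affine_space R n)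
         (iota : T -> gm R n)
         (j : X -> affine_space R n),
    [/\ [/\ real_group_structure tau', real_structure sigma'
          & forall s, sigma' (gm_incl s) = gm_incl (tau' s)],
        [/\ closed_immersion iota, group_morphism iota
          & real_morphism tau tau' iota]
      & [/\ closed_immersion j, real_morphism sigma sigma' j
          & forall t x, j (mu t x) = gm_act (iota t) (j x)]].
Proof.
move=> algT e_imm s_invol f_wt chi_s f_s Q_mor QE r_mor rE.
have [affT _ _ inv_mor] := algT; have algTf := affine_variety_algebra affT.
have algAm := affine_space_algebra R m.
have algX := closed_immersion_algebra e_imm algAm.
have chi_char i : character (chi i) by have [] := f_wt i.
have iota_sub t : [forall i, [ffun i => chi i t] i != 0].
  by apply/forallP => i; rewrite ffunE; have [] := chi_char i.
pose iota t : gm R n := gm_mk (iota_sub t).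
pose j x : affine_space R n := [ffun i => f i x].
have iotaE t i : val (iota t) i = chi i t by rewrite ffunE.
have iota_mor : var_morphism iota.
  apply: morphism_to_gm => // i; have [chi_reg _ _] := chi_char i.
    by apply: eq_regular chi_reg => t; rewrite ffunE.
  apply: eq_regular (inv_mor _ chi_reg) => t.
  by rewrite ffunE characterV.
have j_mor : var_morphism j.
  apply: morphism_to_affine_space => // i; have [_ f_reg _] := f_wt i.
  by apply: eq_regular f_reg => x; rewrite ffunE.
have iota_imm : closed_immersion iota.
  apply: (closed_immersion_factor (closed_immersion_id T) iota_mor r_mor).
  - by [].
  - by move=> t; apply: rE.
  - exact: gm_algebra.
  - exact: gm_separated.
have j_imm : closed_immersion j.
  have /fin_all_exists[P DP] (i : 'I_n) : exists P : affine_space R m -> R[i],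
      regular P /\ forall x, f i x = P (e x).
    have [_ f_reg _] := f_wt i; have [_ _ _ e_ext] := e_imm.
    by have [P P_reg PE] := e_ext _ f_reg; exists P.
  apply: (@closed_immersion_factor _ _ _ _ e j
    (fun y => [ffun i => P i y]) Q) => //.
  - apply: morphism_to_affine_space => // i.
    by apply: eq_regular (DP i).1 => y; rewrite ffunE.
  - by move=> x; apply/ffunP => i; rewrite !ffunE -(DP i).2.
  - exact: affine_space_algebra.
  - exact: affine_space_separated.
exists (gm_conj s), (affine_conj s), iota, j; split; split=> //.
- exact: gm_conj_real_group_structure.
- exact: affine_conj_real_structure.
- split=> // u v; apply: gm_val_inj => i; rewrite !ffunE.
  by have [_ -> _] := chi_char i.
- split=> // t; apply: gm_val_inj => i.
  by rewrite !ffunE chi_s conjCK.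
- split=> // x; apply/ffunP => i.
  by rewrite !ffunE f_s conjCK.
- move=> t x; apply/ffunP => i; rewrite !ffunE.
  by have [_ _ ->] := f_wt i.
Qed.

Lemma weight_vector0 (T : group_space R) (X : fun_space R) (mu : T -> X -> X)
    (chi : T -> R[i]) :
  function_algebra X -> character chi -> weight_vector mu chi (fun _ => 0).
Proof. by move=> [cstX _ _] chi_char; split=> // t x; rewrite mulr0. Qed.

End Linearisation.

Theorem proposition2 (R : realType) (d : nat)
    (T : group_space R) (tau : T -> T)
    (hT : torus d T) (htau : real_group_structure tau)
    (X : fun_space R) (sigma : X -> X)
    (hX : affine_variety X) (hsigma : real_structure sigma)
    (mu : T -> X -> X) (hmu : real_torus_action tau sigma mu) :
  exists n : nat, (d <= n)%N /\
  exists (tau' : gm R n -> gm R n)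
         (sigma' : affine_space R n -> affine_space R n)
         (iota : T -> gm R n)
         (j : X -> affine_space R n),
    [/\ [/\ real_group_structure tau', real_structure sigma'
          & forall s, sigma' (gm_incl s) = gm_incl (tau' s)],
        [/\ closed_immersion iota, group_morphism iota
          & real_morphism tau tau' iota]
      & [/\ closed_immersion j, real_morphism sigma sigma' j
          & forall t x, j (mu t x) = gm_act (iota t) (j x)]].
Proof.
have algX := affine_variety_algebra hX.
have [_ [m [e e_imm]]] := hX.
have [algT [phi [psi [phi_mor psi_mor phiK psiK]]]] := hT.
have [act_mu _ [_ mu_sigma]] := hmu.
have [[tau_invol _] _ _ _] := htau; have [sigma_invol _] := hsigma.
have /fin_all_exists[u Du] (l : 'I_m) : exists u : {N : nat &
    (('I_N -> T -> R[i]) * ('I_N -> X -> R[i]))%type},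
    (forall i, weight_vector mu ((projT2 u).1 i) ((projT2 u).2 i)) /\
    (forall x, e x l = \sum_i (projT2 u).2 i x).
  have [e_mor _ _ _] := e_imm.
  have [N [chi [h [h_wt De]]]] := weight_decomposition hT algX act_mu
    (e_mor (fun y : affine_space R m => y l) (affine_space_coord R l)).
  by exists (existT _ N (chi, h)).
(* K indexes the weight components of the coordinates of e, followed by d zero
   functions carrying the coordinate characters of T as weights; the boolean in
   J marks conjugates, so that conjugation negates it. *)
pose K : finType := ({l : 'I_m & 'I_(projT1 (u l))} + 'I_d)%type.
pose chi0 (k : K) : T -> R[i] := match k with
  | inl a => (projT2 (u (tag a))).1 (tagged a)
  | inr i => fun t => val (phi t) i end.
pose f0 (k : K) : X -> R[i] := match k with
  | inl a => (projT2 (u (tag a))).2 (tagged a)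
  | inr i => fun=> 0 end.
have f0_wt k : weight_vector mu (chi0 k) (f0 k).
  case: k => [a|i] /=; first exact: (Du _).1.
  by apply: weight_vector0 => //; exact: torus_coord_character.
pose J : finType := (K * bool)%type.
pose chi (i : 'I_#|J|) t : R[i] := let a := enum_val i in
  if a.2 then (chi0 a.1 (tau t))^* else chi0 a.1 t.
pose f (i : 'I_#|J|) x : R[i] := let a := enum_val i in
  if a.2 then (f0 a.1 (sigma x))^* else f0 a.1 x.
pose s (i : 'I_#|J|) : 'I_#|J| :=
  let a := enum_val i in enum_rank (a.1, ~~ a.2).
(* Each coordinate of e is the sum of its weight components. *)
pose Q (z : affine_space R #|J|) : affine_space R m :=
  [ffun l => \sum_(i < projT1 (u l)) z (enum_rank (inl (Tagged _ i), false))].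
have pr_sub (z : gm R #|J|) :
    [forall i : 'I_d, [ffun i => val z (enum_rank (inr i, false))] i != 0].
  by apply/forallP => i; rewrite ffunE gm_coord_neq0.
pose pr (z : gm R #|J|) : gm R d := gm_mk (pr_sub z).
have pr_mor : var_morphism pr.
  apply: morphism_to_gm => [|i|i]; first exact: gm_algebra.
  - by apply: eq_regular (gm_coord R (enum_rank (inr i, false)))
      => z; rewrite ffunE.
  - by apply: eq_regular (gm_coord_inv R (enum_rank (inr i, false)))
      => z; rewrite ffunE.
exists #|J|; split.
  rewrite card_prod card_bool card_sum card_ord.
  by apply: leq_trans (leq_addl _ _) _; exact: leq_pmulr.
apply: (real_linearisation (s := s) (chi := chi) (f := f) (e := e) (Q := Q)
  (r := psi \o pr)) => //.
- by move=> i; rewrite /s enum_rankK /= negbK -surjective_pairing enum_valK.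
- move=> i; rewrite /chi /f; case: (enum_val i) => k [] //=.
  by apply: weight_vector_conj => // t x; exact: (mu_sigma (t, x)).
- move=> i t; rewrite /chi /s enum_rankK; case: (enum_val i) => k [] //=.
  by rewrite tau_invol conjCK.
- move=> i x; rewrite /f /s enum_rankK; case: (enum_val i) => k [] //=.
  by rewrite sigma_invol conjCK.
- have algAn := affine_space_algebra R #|J|.
  apply: morphism_to_affine_space => // l.
  apply: (@eq_regular _ _ (fun z : affine_space R #|J| =>
    \sum_(i < projT1 (u l)) z (enum_rank (inl (Tagged _ i), false)))) => [z|].
    by rewrite ffunE.
  apply: (regular_sum _ (F := fun i (z : affine_space R #|J|) =>
    z (enum_rank (inl (Tagged _ i), false)))) => // i.
  exact: affine_space_coord.
- move=> x; apply/ffunP => l; rewrite ffunE (Du l).2.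
  by apply: eq_bigr => i _; rewrite ffunE /f enum_rankK.
- by move=> g g_reg; exact: pr_mor _ (psi_mor.1 _ g_reg).
- move=> z t Dz; rewrite -[RHS]phiK; congr psi; apply: gm_val_inj => i.
  by rewrite ffunE Dz /chi enum_rankK.
Qed.
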